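(* Let $P$ be a decreasing tableau, $(r_1,c_1)$ a removable cell of $P$, $\alpha\in\{0,1\}$, and let $\Psi(P,(r_1,c_1),\alpha)=(P',m)$. Let $(r_2,c_2)$ be a removable cell of $P'$, $\alpha'\in\{0,1\}$, and $\Psi(P',(r_2,c_2),\alpha')=(P'',m')$. Then $c_2<c_1$ if and only if $m'>m$.
   Context: Tableaux use English notation; cell $(i,j)$ is in row $i$, column $j$. A decreasing tableau is a filling of the diagram of a partition by positive integers strictly decreasing from left to right along rows and from top to bottom along columns. A cell is removable if it is the last cell of its row and the bottom cell of its column. $P_{>r}$ denotes the tableau obtained by deleting the first $r$ rows of $P$ (rows renumbered from 1), $P_{\ge r}=P_{>r-1}$. A value $x$ is $P$-ejectable if $x$ occurs in the first row of $P$ and either $x-1$ does not occur in the first row, or $x-1$ occurs in the first row and $x-1$ is $P_{>1}$-ejectable (nothing is ejectable in the empty tableau). Bumping path of a removable cell $(r,c)$ of $P$: $m_r$ is the entry of $P$ at $(r,c)$, and for $i=r-1,\dots,1$, $m_i$ is the smallest entry of row $i$ of $P$ with $m_i>m_{i+1}$ (taken with its position). Reverse insertion $\Psi(P,(r,c),\alpha)=(P',m)$: compute the bumping path $m_r<\dots<m_1$ of $(r,c)$ in $P$; set $m:=m_1$ and working tableau $P':=P$. If $\alpha=1$, delete the cell $(r,c)$ (with $m_r$) from $P'$, set $\alpha_r=1$, and process rows $i=r-1,\dots,1$. If $\alpha=0$, set $m_{r+1}=0$, $\alpha_{r+1}=0$, and process rows $i=r,\dots,1$. Processing row $i$, with $R$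 the set of entries of row $i$ of $P$: (D) if $m_i-1\in R$, leave row $i$ unchanged and set $\alpha_i=\alpha_{i+1}$; (DR) otherwise, if $\alpha_{i+1}=1$ and $m_{i+1}\notin R$, replace $m_i$ in row $i$ of $P'$ by $m_{i+1}$ and set $\alpha_i=1$; otherwise let $x$ be the smallest $P'_{>i}$-ejectable value (for the current $P'$) with $m_{i+1}<x<m_i$: (IR) if $x$ exists, replace $m_i$ in row $i$ of $P'$ by $x$ and set $\alpha_i=1$; (NR) if not, leave row $i$ unchanged and set $\alpha_i=0$. The output is the final $P'$ and $m$. *)

(* Defs.v *)
From mathcomp Require Import all_boot.

Set Implicit Arguments.
Unset Strict Implicit.
Unset Printing Implicit Defensive.

(* A tableau is the sequence of its rows, from top to bottom.  Rows and columns
   are numbered from 0, so the cell (i, j) of the usual 1-based numbering is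
   (i.-1, j.-1) here, and the rows strictly below row i form [drop i.+1 P]. *)
Definition tableau := seq (seq nat).

Definition trow (P : tableau) (i : nat) : seq nat := nth [::] P i.

Definition entry (P : tableau) (i j : nat) : nat := nth 0 (trow P i) j.

Definition in_diagram (P : tableau) (i j : nat) : bool := j < size (trow P i).

(* Empty rows are excluded, so that each diagram has a unique encoding. *)
Definition decreasing_tableau (P : tableau) : Prop :=
  [/\ [::] \notin P /\ sorted geq (map size P),
      all (all (fun x => 0 < x)) P,
      all (sorted gtn) P
    & forall i j, in_diagram P i.+1 j -> entry P i.+1 j < entry P i j].

Definition removable (P : tableau) (rc : nat * nat) : bool :=
  let: (r, c) := rc in
  [&& in_diagram P r c, ~~ in_diagram P r c.+1 & ~~ in_diagram P r.+1 c].

(* Entries are positive, so x.-1 is a true predecessor, and it does not occur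
   in a row when x = 1. *)
Fixpoint ejectable (P : tableau) (x : nat) : bool :=
  if P is s :: Q then
    (x \in s) &&
      ((x.-1 \notin s) || ((x.-1 \in s) && ejectable Q x.-1))
  else false.

(* The default 0 is never reached on a decreasing tableau: the entry above an
   entry y of the next row is larger than y. *)
Definition least_above (s : seq nat) (y : nat) : nat :=
  head 0 [seq x <- sort leq s | y < x].

(* The entry of the bumping path k rows above row r. *)
Fixpoint bump_up (P : tableau) (r c k : nat) : nat :=
  if k is k'.+1 then least_above (trow P (r - k)) (bump_up P r c k')
  else entry P r c.

(* The entry m_i of the bumping path of (r, c), extended by 0 below row r. *)
Definition bump (P : tableau) (rc : nat * nat) (i : nat) : nat :=
  let: (r, c) := rc in if i <= r then bump_up P r c (r - i) else 0.

(* A row that becomes empty is dropped. *)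
Definition delete_cell (P : tableau) (rc : nat * nat) : tableau :=
  let: (r, c) := rc in
  [seq s <- set_nth [::] P r (take c (trow P r)) | s != [::]].

Definition replace_in_row (P : tableau) (i y x : nat) : tableau :=
  set_nth [::] P i [seq if z == y then x else z | z <- trow P i].

(* The smallest Q-ejectable x with lo < x < hi, if there is one. *)
Definition least_ejectable (Q : tableau) (lo hi : nat) : option nat :=
  ohead [seq x <- index_iota lo.+1 hi | ejectable Q x].

(* One step of reverse insertion: P is the initial tableau, m its bumping path,
   and the state consists of the working tableau and of the bit alpha_(i+1);
   the new state contains alpha_i.  The cases are D, DR, IR and NR in turn. *)
Definition process_row (P : tableau) (m : nat -> nat) (i : nat)
    (st : tableau * bool) : tableau * bool :=
  let: (W, a) := st in
  let R := trow P i in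
  if (m i).-1 \in R then (W, a)
  else if a && (m i.+1 \notin R) then (replace_in_row W i (m i) (m i.+1), true)
  else if least_ejectable (drop i.+1 W) (m i.+1) (m i) is Some x then
    (replace_in_row W i (m i) x, true)
  else (W, false).

(* Processes rows n.-1, ..., 0, in this order. *)
Fixpoint process_rows (P : tableau) (m : nat -> nat) (n : nat)
    (st : tableau * bool) : tableau * bool :=
  if n is i.+1 then process_rows P m i (process_row P m i st) else st.

Definition reverse_insertion (P : tableau) (rc : nat * nat) (alpha : bool) :
    tableau * nat :=
  let m := bump P rc in
  let st := if alpha then process_rows P m rc.1 (delete_cell P rc, true)
            else process_rows P m rc.1.+1 (P, false) in
  (st.1, m 0).

(* Main.v *)
(* Write m_i and m'_i for the two bumping paths, R'_i for row i of P', and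
   alpha_i for the bits of the first insertion.  The values of a bumping path
   are ejectable from the rows on which it lives.

   If c2 < c1, then m'_i > m_i for every row i <= r1 of the second path, by
   induction going up: since m'_(i+1) > m_(i+1) is ejectable from the part of P'
   below row i, the minimality of the ejectable value x chosen in case IR (its
   absence in case NR) shows that the entries of R'_i above m'_(i+1) exceed m_i.

   If c2 >= c1, then m'_i <= m_i, strictly when alpha_i = 1, again by induction
   going up: in each of the cases D, DR, IR, NR the row R'_i has an entry above
   m'_(i+1) which is at most m_i, and less than m_i when alpha_i = 1. *)
Require Import Defs.
From mathcomp Require Import all_boot zify.
Import Defs.

(** * Least entries above a bound and ejectable values *)

Lemma least_above_leq (s : seq nat) (y z : nat) :
  z \in s -> y < z -> least_above s y <= z.
Proof.
move=> zs yz; rewrite /least_above.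
have : z \in [seq x <- sort leq s | y < x] by rewrite mem_filter yz mem_sort.
have : sorted leq [seq x <- sort leq s | y < x].
  exact/sorted_filter/sort_sorted/leq_total/leq_trans.
case: [seq _ <- _ | _] => //= w l wl; rewrite inE => /predU1P[->//|zl].
exact: (allP (order_path_min leq_trans wl)).
Qed.

Lemma least_aboveP (s : seq nat) (y z : nat) :
  z \in s -> y < z -> least_above s y \in s /\ y < least_above s y.
Proof.
move=> zs yz; rewrite /least_above.
have zl : z \in [seq x <- sort leq s | y < x] by rewrite mem_filter yz mem_sort.
have : {subset [seq x <- sort leq s | y < x] <= [pred x in s | y < x]}.
  by move=> x; rewrite mem_filter mem_sort inE andbC.
case: [seq _ <- _ | _] zl => //= w l _ /(_ w); rewrite !inE eqxx.
by move/(_ isT)/andP.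
Qed.

Lemma ejectable_dropE (Q : tableau) (i x : nat) :
  ejectable (drop i Q) x =
    (x \in trow Q i) &&
      ((x.-1 \notin trow Q i) || ejectable (drop i.+1 Q) x.-1).
Proof.
rewrite /trow; case: (ltnP i (size Q)) => iQ; last first.
  by rewrite drop_oversize // nth_default.
rewrite (drop_nth [::] iQ) /=.
by case: (x.-1 \in _).
Qed.

(** If the predecessor of the new value is in the row, minimality forces it to be at most [y], hence
    equal to [y]. So ejectability propagates up a bumping path. *)
Lemma ejectable_least_above (Q : tableau) (i y z : nat) :
  z \in trow Q i -> y < z -> ejectable (drop i.+1 Q) y ->
  ejectable (drop i Q) (least_above (trow Q i) y).
Proof.
move=> zQ yz ej_y; have [xQ lt_x] := least_aboveP _ _ _ zQ yz.
rewrite ejectable_dropE xQ /=; case: (boolP (_.-1 \in _)) => //= x1Q.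
suff <- : y = (least_above (trow Q i) y).-1 by [].
have := least_above_leq _ y _ x1Q; lia.
Qed.

(** Rows are compared through [trow], so the two tableaux may differ in length; the induction is on
    the number of remaining rows of the longer one. *)
Lemma eq_ejectable_drop (Q Q' : tableau) (i : nat) :
  (forall j, i <= j -> trow Q j = trow Q' j) ->
  ejectable (drop i Q) =1 ejectable (drop i Q').
Proof.
have [n] := ubnP (maxn (size Q) (size Q') - i).
elim: n i => // n IHn i lt_n eqQ x.
rewrite (ejectable_dropE Q) (ejectable_dropE Q') (eqQ i (leqnn i)).
case: (boolP (x \in _)) => //= xQ'.
rewrite IHn // => [|j ij]; last exact/eqQ/ltnW.
have iQ' : i < size Q'.
  by rewrite ltnNge; apply: contraL xQ' => Q'i; rewrite /trow nth_default.
have iQQ' : i < maxn (size Q) (size Q') by rewrite leq_max iQ' orbT.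
by rewrite -ltnS; apply: leq_trans lt_n; rewrite ltnS ltn_sub2l.
Qed.

(** * Decreasing rows and bumping paths *)

Lemma sorted_gtn_nth (s : seq nat) (i j : nat) :
  sorted gtn s -> i < j -> j < size s -> nth 0 s j < nth 0 s i.
Proof.
move=> ss ij js.
have gtn_trans : transitive gtn by move=> ? ? ? /= + +; lia.
by apply: (sorted_ltn_nth gtn_trans 0 ss) => //; rewrite inE //; lia.
Qed.

Lemma sorted_gtn_last (s : seq nat) (c u : nat) :
  sorted gtn s -> size s <= c.+1 -> u \in s -> nth 0 s c <= u.
Proof.
move=> ss sc /(nthP 0)[k ks <-].
have: k <= c by exact: leq_trans ks sc.
rewrite leq_eqVlt => /predU1P[->//|kc].
case: (ltnP c (size s)) => cs; first exact/ltnW/sorted_gtn_nth.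
by rewrite nth_default.
Qed.

Lemma bump_ltE (Q : tableau) (r c i : nat) : i < r ->
  bump Q (r, c) i = least_above (trow Q i) (bump Q (r, c) i.+1).
Proof.
move=> ir; rewrite /bump (ltnW ir) ir -(subnSK ir) /= subnSK //.
by rewrite subKn // ltnW.
Qed.

Lemma bump_last (Q : tableau) (r c : nat) : bump Q (r, c) r = entry Q r c.
Proof. by rewrite /bump leqnn subnn. Qed.

Lemma bump_below (Q : tableau) (r c : nat) : bump Q (r, c) r.+1 = 0.
Proof. by rewrite /bump ltnn. Qed.

(** Row [r] obeys the same rule as the rows above it: its path entry is the last, hence the least,
    of the row. Only sortedness of that row is asked, so that both [P] and the result of the first
    insertion qualify. *)
Lemma bump_leq (Q : tableau) (r c i u : nat) :
  sorted gtn (trow Q r) -> ~~ in_diagram Q r c.+1 -> i <= r ->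
  u \in trow Q i -> bump Q (r, c) i.+1 < u -> bump Q (r, c) i <= u.
Proof.
move=> sr nc; rewrite leq_eqVlt => /predU1P[-> ur _|ir ui lt_u].
  by rewrite bump_last; apply: sorted_gtn_last => //; rewrite leqNgt.
by rewrite bump_ltE // least_above_leq.
Qed.

(** * Paths of removable cells in a decreasing tableau *)

Section DecreasingTableau.

Variables (P : tableau) (decP : decreasing_tableau P).

Lemma trow_sorted (i : nat) : sorted gtn (trow P i).
Proof.
case: decP => _ _ /allP sP _; case: (ltnP i (size P)) => iP.
  exact/sP/mem_nth.
by rewrite /trow nth_default.
Qed.

Lemma trow_gt0 (i u : nat) : u \in trow P i -> 0 < u.
Proof.
case: decP => _ /allP pP _ _; case: (ltnP i (size P)) => iP.
  by apply/allP/pP/mem_nth.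
by rewrite /trow nth_default.
Qed.

Lemma size_trow_leq (i j : nat) : i <= j -> size (trow P j) <= size (trow P i).
Proof.
case: decP => -[_ sP] _ _ _ ij; case: (ltnP j (size P)) => jP; last first.
  by rewrite {1}/trow nth_default.
have geq_trans : transitive geq by move=> ? ? ? /= + +; lia.
have:= sorted_leq_nth geq_trans leqnn 0 sP i j.
rewrite !inE size_map !(nth_map [::]) //; last lia.
by apply => //; lia.
Qed.

Lemma entry_above (i u : nat) : u \in trow P i.+1 ->
  exists2 v, v \in trow P i & u < v.
Proof.
case: decP => _ _ _ colP /(nthP 0)[k ks <-]; exists (entry P i k).
  exact/mem_nth/(leq_trans ks)/size_trow_leq/leqnSn.
exact: colP.
Qed.

(** The witness is the entry above [w]: since [w] stands to the left of [u], it exceeds the entry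
    above [u], which is at least [z]. In the application [u] and [z] are consecutive path
    entries. *)
Lemma entry_above_right (i u w z : nat) :
  u \in trow P i.+1 -> w \in trow P i.+1 -> u < w ->
  (forall v, v \in trow P i -> u < v -> z <= v) ->
  exists v, [/\ v \in trow P i, w < v & z < v].
Proof.
case: decP => _ _ _ colP /(nthP 0)[k ks <-] /(nthP 0)[l ls <-] lt_kl min_z.
have lk : l < k.
  rewrite ltnNge; apply/negP; rewrite leq_eqVlt => /predU1P[kl|kl].
    by rewrite kl ltnn in lt_kl.
  have := ltn_trans lt_kl (sorted_gtn_nth _ _ _ (trow_sorted i.+1) kl ls).
  by rewrite ltnn.
have ki : k < size (trow P i) by apply/(leq_trans ks)/size_trow_leq.
exists (entry P i l); split.
- exact/mem_nth/(ltn_trans lk).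
- exact: colP.
- apply: (@leq_ltn_trans (entry P i k)); last exact/sorted_gtn_nth/ki/lk/trow_sorted.
  by apply/min_z; [exact/mem_nth | exact: colP].
Qed.

Section Removable.

Variables (r c : nat) (rem_rc : removable P (r, c)).

Lemma size_removable_row : size (trow P r) = c.+1.
Proof. by move: rem_rc; rewrite /= /in_diagram => /and3P[]; lia. Qed.

Lemma size_below_removable (i : nat) : r < i -> size (trow P i) <= c.
Proof.
move=> ri; apply: leq_trans (size_trow_leq _ _ ri) _.
by case/and3P: rem_rc => _ _; rewrite -leqNgt.
Qed.

Lemma entry_above_removable (u : nat) : u \in trow P r.+1 ->
  exists v, [/\ v \in trow P r, u < v & entry P r c < v].
Proof.
case: decP => _ _ _ colP /(nthP 0)[k ks <-]; exists (entry P r k).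
have kc := leq_trans ks (size_below_removable _ (ltnSn r)).
have kr : k < size (trow P r) by rewrite size_removable_row ltnS ltnW.
split; [exact: mem_nth | exact: colP |].
by apply: sorted_gtn_nth; rewrite ?size_removable_row //; apply: trow_sorted.
Qed.

Lemma bump_gap (i u : nat) : i <= r ->
  u \in trow P i -> bump P (r, c) i.+1 < u -> bump P (r, c) i <= u.
Proof.
apply: bump_leq; first exact: trow_sorted.
by rewrite /in_diagram size_removable_row ltnn.
Qed.

Lemma bump_mem (i : nat) : i <= r -> bump P (r, c) i \in trow P i.
Proof.
move=> ir; rewrite -(subKn ir); have := leq_subr i r.
elim: (r - i) => [_|k IHk kr].
  by rewrite subn0 bump_last mem_nth // size_removable_row.
rewrite bump_ltE; last lia.
have := IHk (ltnW kr); rewrite -subnSK // => /entry_above[v vP lt_v].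
by case: (least_aboveP _ _ _ vP lt_v).
Qed.

Lemma bump_lt (i : nat) : i <= r -> bump P (r, c) i.+1 < bump P (r, c) i.
Proof.
move=> ir; have := bump_mem _ ir; move: ir.
rewrite leq_eqVlt => /predU1P[->|ir]; first by rewrite bump_below => /trow_gt0.
move=> _; rewrite (bump_ltE P r c i) //.
have [v vP lt_v] := entry_above _ _ (bump_mem _ ir).
by case: (least_aboveP _ _ _ vP lt_v).
Qed.

(** When [c] is 0 the row becomes empty and is dropped; removability makes it the last row, so no
    other row is renumbered. *)
Lemma trow_delete_cell (j : nat) :
  trow (delete_cell P (r, c)) j =
    if j == r then take c (trow P r) else trow P j.
Proof.
have rP : r < size P.
  have := size_removable_row; rewrite /trow.
  by case: leqP => // Pr; rewrite nth_default.
have nP : all (fun s => s != [::]) P.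
  case: decP => -[nP _] _ _ _.
  by apply/allP => s sP; apply: contraNneq nP => <-.
rewrite /delete_cell; case: (posnP c) => [c0|c_gt0].
  have lastr : size P = r.+1.
    apply/eqP; rewrite eqn_leq rP andbT leqNgt; apply/negP => rP1.
    have := size_below_removable _ (ltnSn r).
    rewrite c0 leqn0 size_eq0; apply/negP.
    exact: (allP nP _ (mem_nth [::] rP1)).
  rewrite c0 take0 /trow; case: (lastP P) lastr nP => // Q s.
  rewrite size_rcons => -[<-]; rewrite all_rcons => /andP[_ /all_filterP nQ].
  rewrite set_nthE size_rcons ltnS leqnn -cats1 take_size_cat // drop_oversize; last first.
    by rewrite size_cat addn1.
  rewrite filter_cat nQ /= cats0 nth_cat.
  case: ltngtP => // jQ; last by rewrite nth_default ?jQ.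
  by rewrite !nth_default //= ?subn_gt0 // ltnW.
rewrite (all_filterP _) /trow ?nth_set_nth //=.
apply/(all_nthP [::]) => k; rewrite size_set_nth (maxn_idPr rP) nth_set_nth /= => kP.
case: (k == r); last exact: (all_nthP [::] nP).
by rewrite -size_eq0 size_take size_removable_row ltnSn -lt0n.
Qed.

End Removable.

End DecreasingTableau.

(** * The effect of reverse insertion on one row *)

Definition subst (y x : nat) (s : seq nat) : seq nat :=
  [seq if z == y then x else z | z <- s].

(* [E] is the set of values ejectable from the part of the final tableau below
   the row [R] being processed; [lo], [hi] are m_(i+1), m_i. *)
Inductive row_step (E : pred nat) (R : seq nat) (lo hi : nat) (b : bool) :
    seq nat -> bool -> Prop :=
| RowStepD of hi.-1 \in R : row_step E R lo hi b R b
| RowStepDR of b & lo \notin R : row_step E R lo hi b (subst hi lo R) true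
| RowStepIR x of E x & lo < x < hi & (forall e, E e -> lo < e -> x <= e) :
    row_step E R lo hi b (subst hi x R) true
| RowStepNR of (forall e, E e -> lo < e -> hi <= e) :
    row_step E R lo hi b R false.

Lemma eq_row_step (E E' : pred nat) (R : seq nat) (lo hi : nat) (b : bool)
    (R' : seq nat) (b' : bool) :
  E =1 E' -> row_step E R lo hi b R' b' -> row_step E' R lo hi b R' b'.
Proof.
move=> eqE [?|? ?|x ? ? min_x|min_hi]; [exact: RowStepD|exact: RowStepDR| |].
  by apply: RowStepIR; rewrite -?eqE // => e; rewrite -eqE; apply: min_x.
by apply: RowStepNR => e; rewrite -eqE; apply: min_hi.
Qed.

Section RowStep.

Variables (E : pred nat) (R : seq nat) (lo hi : nat) (b : bool).
Variables (R' : seq nat) (b' : bool).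
Hypotheses (stepR : row_step E R lo hi b R' b').
Hypotheses (hiR : hi \in R) (lt_lo_hi : lo < hi).
Hypothesis gap : forall u, u \in R -> lo < u -> hi <= u.

Lemma row_step_size : size R' = size R.
Proof. by case: stepR => *; rewrite ?size_map. Qed.

Lemma row_step_gt (u : nat) : hi < u -> (u \in R') = (u \in R).
Proof.
move=> hiu.
have subst_gt x : x <= hi -> (u \in subst hi x R) = (u \in R).
  move=> xhi; apply/mapP/idP => [[z zR u_z]|uR].
    by move: hiu; rewrite u_z; case: eqP => // _; rewrite ltnNge xhi.
  by exists u => //; case: eqP => // def_u; rewrite def_u ltnn in hiu.
by case: stepR => // [_ _|x _ /andP[_ xhi] _]; apply/subst_gt/ltnW.
Qed.

(** By [gap], the entries of [R] below [hi] are at most [lo]. They stay below the substitute, which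
    exceeds [lo] in case IR and is [lo] itself, absent from [R], in case DR. *)
Lemma row_step_sorted : sorted gtn R -> sorted gtn R'.
Proof.
have subst_sorted x : (forall u, u \in R -> u < hi -> u < x) -> x < hi ->
    sorted gtn R -> sorted gtn (subst hi x R).
  move=> gtx xhi sR; apply: homo_sorted_in (allss R) sR => u v uR vR /= vu.
  case: (eqVneq u hi) => [u_hi|_]; case: (eqVneq v hi) => [v_hi|_] //.
  - by rewrite u_hi v_hi ltnn in vu.
  - by apply: gtx => //; rewrite -u_hi.
  - by apply: ltn_trans xhi _; rewrite -v_hi.
have leq_lo u : u \in R -> u < hi -> u <= lo.
  by move=> uR uhi; rewrite leqNgt; apply/negP => /(gap _ uR); rewrite leqNgt uhi.
case: stepR => // [_ loR|x _ /andP[lox xhi] _]; apply: subst_sorted => // u uR uhi.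
  by rewrite ltn_neqAle leq_lo // andbT; apply: contraNneq loR => <-.
exact: leq_ltn_trans (leq_lo u uR uhi) lox.
Qed.

(** In cases DR and IR the value [hi] has left the row and its substitute is at most [e], so [u] is
    an old entry above [lo] other than [hi]. In cases D and NR already [hi <= e]; for D, [gap]
    forces [hi.-1 <= lo]. *)
Lemma row_step_path_gt (e u : nat) :
  E e -> lo < e -> u \in R' -> e < u -> hi < u.
Proof.
move=> Ee lo_e uR' eu.
have subst_hi x : u \in subst hi x R -> x < u -> lo < u -> hi < u.
  case/mapP => z zR ->; case: eqP => [_|/eqP z_hi _ lo_z]; first by rewrite ltnn.
  by rewrite ltn_neqAle eq_sym z_hi gap.
have lo_u := ltn_trans lo_e eu.
case: stepR uR' => [hi1R _|_ _|x Ex /andP[lo_x x_hi] min_x|min_hi _].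
- suff: hi <= e by move=> /leq_ltn_trans; apply.
  suff: hi.-1 <= lo by move/leq_ltn_trans/(_ lo_e); lia.
  by rewrite leqNgt; apply/negP => /(gap _ hi1R); lia.
- by move/subst_hi; apply.
- by move/subst_hi; apply=> //; apply: leq_ltn_trans eu; apply: min_x.
- exact: leq_ltn_trans (min_hi _ Ee lo_e) eu.
Qed.

(* The strictness carried by the bit is what makes the DR case go through:
   there [lo] itself replaces [hi]. *)
Lemma row_step_path_leq (e : nat) : (if b then e < lo else e <= lo) ->
  exists u, [/\ u \in R', e < u & if b' then u < hi else u <= hi].
Proof.
have mem_subst x : x \in subst hi x R.
  by apply/mapP; exists hi => //; rewrite eqxx.
move=> le_e; have {le_e} [e_lo lt_e] : e <= lo /\ (b -> e < lo).
  by case: (b) le_e => // e_lt; split=> //; apply: ltnW.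
case: stepR => [hi1R|bT _|x _ /andP[lo_x x_hi] _|_].
- case: (b) lt_e => [/(_ isT) e_lt|_]; last first.
    by exists hi; split=> //; apply: leq_ltn_trans lt_lo_hi.
  by exists hi.-1; split=> //; lia.
- by exists lo; split; rewrite ?mem_subst ?lt_e.
- by exists x; split; rewrite ?mem_subst // (leq_ltn_trans e_lo).
- by exists hi; split=> //; apply: leq_ltn_trans lt_lo_hi.
Qed.

End RowStep.

Lemma trow_replace_in_row (W : tableau) (i y x j : nat) :
  trow (replace_in_row W i y x) j =
    if j == i then subst y x (trow W i) else trow W j.
Proof. by rewrite /trow nth_set_nth. Qed.

Lemma process_row_step (P W : tableau) (m : nat -> nat) (i : nat) (b : bool) :
  trow W i = trow P i ->
  let st := process_row P m i (W, b) in
  row_step (ejectable (drop i.+1 W)) (trow P i) (m i.+1) (m i) b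
    (trow st.1 i) st.2
  /\ (forall j, j != i -> trow st.1 j = trow W j).
Proof.
move=> WP; rewrite /process_row /=.
case: ifP => [mD|_]; first by rewrite WP; split=> //; apply: RowStepD.
case: ifP => [/andP[bT mDR]|_] /=.
  split=> [|j /negbTE ji]; rewrite trow_replace_in_row ?ji // eqxx WP.
  exact: RowStepDR.
rewrite /least_ejectable; set E := ejectable _.
have sub x : (x \in [seq x <- index_iota (m i.+1).+1 (m i) | E x]) =
    E x && (m i.+1 < x < m i).
  by rewrite mem_filter mem_index_iota.
have : sorted ltn [seq x <- index_iota (m i.+1).+1 (m i) | E x].
  exact/(sorted_filter ltn_trans)/iota_ltn_sorted.
case: [seq _ <- _ | _] sub => [|x s] sub /=.
  rewrite WP; split=> //; apply: RowStepNR => e Ee lt_e.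
  by rewrite leqNgt; have := sub e; rewrite Ee lt_e in_nil /= => <-.
move=> /(order_path_min ltn_trans)/allP min_x.
have := sub x; rewrite inE eqxx => /esym/andP[Ex /[dup] ltx /andP[_ x_hi]].
split=> [|j /negbTE ji]; rewrite trow_replace_in_row ?ji // eqxx WP.
apply: RowStepIR => // e Ee lt_e; case: (ltnP e (m i)) => [e_hi|hi_e].
  by have := sub e; rewrite Ee lt_e e_hi inE => /predU1P[->//|/min_x/ltnW].
exact/ltnW/(leq_trans x_hi).
Qed.

(** A processed row is never touched again, so the ejectable values consulted at row [i] are those
    of the final tableau. The recursion thus becomes one condition per row, linked only by the
    bits. *)
Lemma process_rows_steps (P : tableau) (m : nat -> nat) (n : nat)
    (st : tableau * bool) :
  (forall j, j < n -> trow st.1 j = trow P j) ->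
  let P' := (process_rows P m n st).1 in
  (forall j, n <= j -> trow P' j = trow st.1 j) /\
  exists2 a : nat -> bool, a n = st.2 &
    forall i, i < n -> row_step (ejectable (drop i.+1 P')) (trow P i)
      (m i.+1) (m i) (a i.+1) (trow P' i) (a i).
Proof.
elim: n st => [|n IHn] [W b] /= eqW; first by split=> //; exists (fun=> b).
have [stepn eqn] := process_row_step P W m n b (eqW n (ltnSn n)).
have [|eqP' [a an stepP']] := IHn (process_row P m n (W, b)).
  by move=> j jn; rewrite eqn ?neq_ltn ?jn // eqW // ltnW.
have eqP'W j : n < j -> trow (process_rows P m n (process_row P m n (W, b))).1 j
    = trow W j.
  by move=> nj; rewrite eqP' ?eqn ?neq_ltn ?nj ?orbT // ltnW.
(* The bits of the remaining rows are extended by the initial bit at index [n.+1]. *)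
split=> //; exists (fun j => if j <= n then a j else b); first by rewrite ltnn.
move=> i /ltnSE le_in; have [->|ne_in] := eqVneq i n.
  rewrite ltnn leqnn an eqP' //; apply: eq_row_step stepn.
  by apply: eq_ejectable_drop => j nj; rewrite eqP'W.
have lt_in : i < n by rewrite ltn_neqAle ne_in.
by rewrite lt_in le_in; apply: stepP'.
Qed.

(** * The tableau after the first insertion *)

Section ReverseInsertion.

Variables (P : tableau) (r c : nat) (alpha : bool).
Hypotheses (decP : decreasing_tableau P) (rem_rc : removable P (r, c)).

Let P' := (reverse_insertion P (r, c) alpha).1.
Let m := bump P (r, c).

(** The bound [r + ~~ alpha] says that row [r] is processed only when [alpha] is 0; otherwise it
    just loses its last cell. *)
Lemma reverse_insertion_steps :
  [/\ forall j, r < j -> trow P' j = trow P j,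
      alpha -> trow P' r = take c (trow P r) &
      exists2 a : nat -> bool,
        (if alpha then a r = true else a r.+1 = false) &
        forall i, i < r + ~~ alpha ->
          row_step (ejectable (drop i.+1 P')) (trow P i) (m i.+1) (m i)
            (a i.+1) (trow P' i) (a i)].
Proof.
rewrite /P' /reverse_insertion -/m /=; case: alpha => /=.
  have [|eqP' [a ar stepP']] :=
      process_rows_steps P m r (delete_cell P (r, c), true).
    by move=> j jr; rewrite /= trow_delete_cell // ltn_eqF.
  split=> [j rj|_|]; last by exists a; rewrite ?addn0.
    by rewrite eqP' ?[LHS]trow_delete_cell // ?gtn_eqF // ltnW.
  by rewrite eqP' ?[LHS]trow_delete_cell ?eqxx.
have [//|eqP' [a ar stepP']] := process_rows_steps P m r.+1 (P, false).
by split=> //; exists a; rewrite ?addn1.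
Qed.

Lemma size_reverse_insertion_row (i : nat) :
  size (trow P' i) = if alpha && (i == r) then c else size (trow P i).
Proof.
have [eqP' delP' [a _ stepP']] := reverse_insertion_steps.
have [lt_ri|lt_ir|<-] := ltngtP r i; rewrite ?andbT ?andbF.
- by rewrite eqP'.
- exact: row_step_size (stepP' i (ltn_addr _ lt_ir)).
case: (boolP alpha) => [aT|aF].
  by rewrite delP' // size_take (size_removable_row _ _ _ rem_rc) ltnSn.
by apply: row_step_size (stepP' r _); rewrite aF addn1.
Qed.

Lemma deleted_row_gt (u : nat) : alpha -> (u \in trow P' r) =
  (u \in trow P r) && (m r < u).
Proof.
have [_ + _] := reverse_insertion_steps => /[apply] ->.
have sr := trow_sorted _ decP r; have size_r := size_removable_row _ _ _ rem_rc.
rewrite /m bump_last; apply/idP/andP => [uc|[/(nthP 0)[k ks <-] lt_u]].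
  split; first exact: mem_take uc.
  case/(nthP 0): uc => k; rewrite size_take size_r ltnSn => kc <-.
  by rewrite nth_take //; apply: sorted_gtn_nth; rewrite ?size_r.
have kc : k < c.
  move: ks; rewrite size_r ltnS ltn_neqAle => ->; rewrite andbT.
  by apply: contraTneq lt_u => ->; rewrite ltnn.
by rewrite -(nth_take 0 kc) mem_nth // size_take size_r ltnSn.
Qed.

Lemma reverse_insertion_row_gt (i u : nat) : i <= r -> m i < u ->
  (u \in trow P' i) = (u \in trow P i).
Proof.
move=> ir lt_u; have [_ _ [a _ stepP']] := reverse_insertion_steps.
have [in_step|] := ltnP i (r + ~~ alpha).
  by apply: row_step_gt (stepP' i in_step) _ _ lt_u; apply: bump_lt.
case: (boolP alpha) => [aT|_]; last by rewrite addn1 ltnNge ir.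
rewrite addn0 => ri; have def_i : i = r by apply/eqP; rewrite eqn_leq ir.
by move: lt_u; rewrite def_i deleted_row_gt // => ->; rewrite andbT.
Qed.

Lemma reverse_insertion_sorted (i : nat) : sorted gtn (trow P' i).
Proof.
have [eqP' delP' [a _ stepP']] := reverse_insertion_steps.
have sP := trow_sorted _ decP.
have [in_step|] := ltnP i (r + ~~ alpha).
  have ir : i <= r by case: (alpha) in_step; rewrite ?addn0 ?addn1 // => /ltnW.
  apply: row_step_sorted (stepP' i in_step) _ _ (sP i); first exact: bump_lt.
  by move=> u; apply: bump_gap.
have [lt_ri _|lt_ir|<-] := ltngtP r i; first by rewrite eqP'.
  by rewrite leqNgt (ltn_addr _ lt_ir).
case: (boolP alpha) => [aT _|_]; last by rewrite addn1 ltnn.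
by rewrite delP' // take_sorted.
Qed.

Lemma reverse_insertion_path_gt (i e u : nat) : i <= r ->
  ejectable (drop i.+1 P') e -> m i.+1 < e -> u \in trow P' i -> e < u ->
  m i < u.
Proof.
move=> ir Ee lt_e uP' eu; have [_ _ [a _ stepP']] := reverse_insertion_steps.
have [in_step|] := ltnP i (r + ~~ alpha).
  apply: row_step_path_gt (stepP' i in_step) _ _ _ _ _ Ee lt_e uP' eu.
  - exact: bump_mem.
  - exact: bump_lt.
  - by move=> v; apply: bump_gap.
(* What remains is the shortened row [r], where only entries above [m r] survive. *)
case: (boolP alpha) => [aT|_]; last by rewrite addn1 ltnNge ir.
rewrite addn0 => ri; have def_i : i = r by apply/eqP; rewrite eqn_leq ir.
by move: uP'; rewrite def_i deleted_row_gt // => /andP[].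
Qed.

(** This keeps [least_above] off its default along the second path. An entry [e] beyond the first
    path was already in [P], and some entry of [P] in the row above exceeds both [e] and [m i],
    hence survives. *)
Lemma reverse_insertion_row_above (i e : nat) :
  e \in trow P' i.+1 -> (i < r -> m i.+1 < e) ->
  exists2 u, u \in trow P' i & e < u.
Proof.
move=> eP' lt_e; have [eqP' _ _] := reverse_insertion_steps.
have [lt_ri|le_ir] := ltnP r i.
  by move: eP'; rewrite !eqP' // 1?ltnW //; apply: entry_above.
suff [v [vP ev lt_v]] : exists v, [/\ v \in trow P i, e < v & m i < v].
  by exists v; rewrite ?reverse_insertion_row_gt.
move: le_ir; rewrite leq_eqVlt => /predU1P[def_i|lt_ir].
  rewrite def_i /m bump_last; apply: entry_above_removable => //.
  by rewrite -eqP' // -def_i.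
apply: entry_above_right decP _ _ _ _ _ _ (lt_e lt_ir) _.
- exact: bump_mem.
- by rewrite -reverse_insertion_row_gt // lt_e.
- by move=> v; apply: bump_gap => //; apply: ltnW.
Qed.

(** * Comparison of the two bumping paths *)

Variables (r2 c2 : nat) (rem2 : removable P' (r2, c2)).

Let m2 := bump P' (r2, c2).

Lemma in_diagram_second : in_diagram P' r2 c2.
Proof. by case/and3P: rem2. Qed.

Lemma second_row_last : ~~ in_diagram P' r2 c2.+1.
Proof. by case/and3P: rem2. Qed.

Lemma second_path_gt : c2 < c -> m 0 < m2 0.
Proof.
move=> c2c; have [eqP' _ _] := reverse_insertion_steps.
(* Rows above row [r] keep their length, at least [c.+1], so they cannot end in column [c2]. *)
have le_r : r <= r2.
  rewrite leqNgt; apply/negP => lt_r2r; have := second_row_last.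
  rewrite /in_diagram size_reverse_insertion_row (ltn_eqF lt_r2r) andbF.
  have := size_trow_leq _ decP _ _ (ltnW lt_r2r).
  rewrite (size_removable_row _ _ _ rem_rc) => c_lt.
  by rewrite (leq_ltn_trans c2c c_lt).
have path k : k <= r2 -> ejectable (drop (r2 - k) P') (m2 (r2 - k)) /\
    (r2 - k <= r -> m (r2 - k) < m2 (r2 - k)).
  elim: k => [_|k IHk lt_k].
    (* The path starts at the least entry of its row, which is positive, so its predecessor is
       absent and it is ejectable. *)
    rewrite subn0 /m2 bump_last; have memP' := mem_nth 0 in_diagram_second.
    have last_leq := sorted_gtn_last _ c2 _ (reverse_insertion_sorted r2).
    have {}last_leq u : u \in trow P' r2 -> entry P' r2 c2 <= u.
      by apply: last_leq; rewrite leqNgt second_row_last.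
    have [last_gt0 m_last] : 0 < entry P' r2 c2 /\
        (r2 <= r -> m r2 < entry P' r2 c2).
      move: le_r memP'; rewrite leq_eqVlt => /predU1P[def_r|lt_r]; last first.
        rewrite /entry eqP' // => /(trow_gt0 _ decP) gt0; split=> //.
        by rewrite leqNgt lt_r.
      (* If [r2 = r], row [r] ends before column [c], so its last cell was deleted. *)
      have aT : alpha.
        have := second_row_last; rewrite /in_diagram size_reverse_insertion_row.
        case: ifP => [/andP[] //|_].
        by rewrite -def_r (size_removable_row _ _ _ rem_rc) ltnS c2c.
      rewrite /entry -def_r.
      by rewrite deleted_row_gt // => /andP[/(trow_gt0 _ decP)].
    split=> //; rewrite ejectable_dropE memP' /=.
    by apply/orP; left; apply/negP => /last_leq; lia.
  have [ej lt_m] := IHk (ltnW lt_k).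
  move: ej lt_m; rewrite -(subnSK lt_k); set i := r2 - k.+1 => ej lt_m.
  have memP' : m2 i.+1 \in trow P' i.+1.
    by move: ej; rewrite ejectable_dropE => /andP[].
  have [u uP' lt_u] := reverse_insertion_row_above _ _ memP' lt_m.
  have lt_ir2 : i < r2 by rewrite /i; lia.
  have [m2P' lt_m2] := least_aboveP _ _ _ uP' lt_u.
  have -> : m2 i = least_above (trow P' i) (m2 i.+1) by exact: bump_ltE.
  split.
    exact: ejectable_least_above uP' lt_u ej.
  move=> le_ir; apply: (reverse_insertion_path_gt _ _ _ le_ir ej _ m2P' lt_m2).
  (* At [i = r] the bound [m r.+1] is 0, and positivity of the entry suffices. *)
  move: le_ir; rewrite leq_eqVlt => /predU1P[def_i|]; last exact: lt_m.
  move: memP'; rewrite def_i /m bump_below eqP' //; exact: trow_gt0.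
have [_] := path r2 (leqnn _); rewrite subnn; exact.
Qed.

Lemma second_path_leq : c <= c2 -> m2 0 <= m 0.
Proof.
move=> c_c2; have [eqP' _ [a a_start stepP']] := reverse_insertion_steps.
(* An unprocessed row has at most [c] cells, too few to reach column [c2]. *)
have lt_r2 : r2 < r + ~~ alpha.
  have := in_diagram_second; rewrite /in_diagram ltnNge; apply: contraR.
  rewrite -leqNgt => le_r2.
  rewrite size_reverse_insertion_row; case: ifP => [//|].
  move=> ar; apply: leq_trans c_c2; apply: size_below_removable rem_rc _ _ => //.
  by move: le_r2 ar; case: (alpha); rewrite ?addn1 //= addn0 leq_eqVlt eq_sym => /orP[->|].
have le_r2 : r2 <= r by case: (alpha) lt_r2; rewrite ?addn1 // addn0 => /ltnW.
(* The induction starts one row below [r2], where the second path has value 0, so row [r2] is an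
   ordinary step. *)
have path k : k <= r2.+1 ->
    if a (r2.+1 - k) then m2 (r2.+1 - k) < m (r2.+1 - k)
    else m2 (r2.+1 - k) <= m (r2.+1 - k).
  elim: k => [_|k IHk lt_k].
    rewrite subn0 {1 2}/m2 bump_below; case: ifP => // a_r2.
    (* A set bit at [r2.+1] rules out [r2 = r], so the first path has a positive entry in row
       [r2.+1]. *)
    suff lt_r : r2 < r by apply: trow_gt0 (bump_mem _ decP _ _ rem_rc _ lt_r).
    case: (alpha) a_start lt_r2; rewrite ?addn0 ?addn1 // => a_r.
    rewrite ltnS leq_eqVlt => /predU1P[def_r|//].
    by rewrite def_r a_r in a_r2.
  have {IHk} := IHk (ltnW lt_k); rewrite -(subnSK lt_k).
  have : r2.+1 - k.+1 <= r2 by lia.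
  move: (_ - _) => i le_i le_m2.
  have le_ir := leq_trans le_i le_r2.
  have [u [uP' lt_u le_u]] := row_step_path_leq _ _ _ _ _ _ _
    (stepP' i (leq_ltn_trans le_i lt_r2)) (bump_mem _ decP _ _ rem_rc _ le_ir)
    (bump_lt _ decP _ _ rem_rc _ le_ir) _ le_m2.
  have le_m2u : m2 i <= u.
    exact: bump_leq (reverse_insertion_sorted r2) second_row_last le_i uP' lt_u.
  by move: le_u; case: ifP => _; apply: leq_ltn_trans || apply: leq_trans.
have := path r2.+1 (leqnn _); rewrite subnn; case: ifP => // _; exact: ltnW.
Qed.

End ReverseInsertion.

Theorem theorem5p8 (P P' P'' : tableau) (r1 c1 r2 c2 m m' : nat)
    (alpha alpha' : bool) :
  decreasing_tableau P ->
  removable P (r1, c1) ->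
  reverse_insertion P (r1, c1) alpha = (P', m) ->
  removable P' (r2, c2) ->
  reverse_insertion P' (r2, c2) alpha' = (P'', m') ->
  (c2 < c1) <-> (m' > m).
Proof.
move=> decP rem1 ins1 rem2 [_ <-]; have [_ <-] := ins1.
have {}rem2 : removable (reverse_insertion P (r1, c1) alpha).1 (r2, c2).
  by rewrite ins1.
have -> : P' = (reverse_insertion P (r1, c1) alpha).1 by rewrite ins1.
split; first exact: second_path_gt.
by rewrite !ltnNge; apply: contraNN; apply: second_path_leq.
Qed.
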